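(* Let $\alpha,\beta>0$ and $\theta\in(0,1)$. Let $Y_\alpha\sim\mathcal{G}a(\alpha)$ and $Y_i\sim\mathcal{G}a(1)$, $i=1,2,\dots$, be mutually independent, and let $X_i=\beta\,Y_i/Y_\alpha$ for $i\ge 1$. Let $N$ be a random variable with the logarithmic distribution $$\Pr(N=n)=-\frac{1}{\log(1-\theta)}\frac{\theta^n}{n},\quad n=1,2,\dots,$$ independent of $(X_i)_{i\ge1}$, and let $S_N=X_1+\dots+X_N$. Then $S_N$ has probability density function $$f_{S_N}(x;\alpha,\beta,\theta)=-\frac{1}{\log(1-\theta)}\left[\frac{1}{x(1+(1-\theta)x/\beta)^\alpha}-\frac{1}{x(1+x/\beta)^\alpha}\right],\quad x>0,$$ and $f_{S_N}(x;\alpha,\beta,\theta)=0$ if $x<0$.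
   Context: For $a>0$, $\mathcal{G}a(a)$ denotes the gamma distribution with probability density function $x^{a-1}e^{-x}/\Gamma(a)$ for $x>0$. *)

(* Defs.v *)
From HB Require Import structures.
From mathcomp Require Import all_boot all_order all_algebra finmap.
From mathcomp Require Import all_classical all_reals all_analysis.
From mathcomp Require Import measurable_realfun.

Set Implicit Arguments.
Unset Strict Implicit.
Unset Printing Implicit Defensive.

Import Order.TTheory GRing.Theory Num.Def Num.Theory.
Import numFieldNormedType.Exports.

Local Open Scope classical_set_scope.
Local Open Scope ring_scope.

Section independence.
Context d (T : measurableType d) (R : realType) (P : probability T R).

(* Product rule over every finite subfamily. *)
Definition mutually_independent_RV d' (T' : measurableType d')
    (I : choiceType) (X : I -> {RV P >-> T'}) : Prop :=
  forall (J : {fset I}) (A : I -> set T'),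
    (forall i, measurable (A i)) ->
    P (\bigcap_(i in [set` J]) (X i @^-1` A i)) =
    (\prod_(i <- J) P (X i @^-1` A i))%E.

Definition independent_set_systems (F G : set (set T)) : Prop :=
  forall A B, F A -> G B -> P (A `&` B) = (P A * P B)%E.

Definition sigma_of_process d' (T' : measurableType d') (I : Type)
    (X : I -> {RV P >-> T'}) : set (set T) :=
  <<s \bigcup_i g_sigma_algebra_preimage (X i) >>.

Definition independent_of_process d1 (T1 : measurableType d1)
    d2 (T2 : measurableType d2) (I : Type)
    (N : {RV P >-> T1}) (X : I -> {RV P >-> T2}) : Prop :=
  independent_set_systems (g_sigma_algebra_preimage N) (sigma_of_process X).

End independence.

Arguments mutually_independent_RV {d T R} P {d' T' I} X.
Arguments independent_of_process {d T R} P {d1 T1 d2 T2 I} N X.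

Definition has_pdf d (T : measurableType d) (R : realType)
    (P : probability T R) (X : {RV P >-> R}) (f : R -> R) : Prop :=
  [/\ measurable_fun [set: R] f,
      forall x, 0 <= f x &
      forall A : set R, measurable A ->
        distribution P X A = (\int[lebesgue_measure]_(x in A) (f x)%:E)%E].

Arguments has_pdf {d T R} P X f.

Section densities.
Context {R : realType}.

Definition gamma_fun (a : R) : R :=
  \int[lebesgue_measure]_(x in `]0, +oo[) (x `^ (a - 1) * expR (- x)).

Definition gamma_pdf (a : R) (x : R) : R :=
  if 0 < x then x `^ (a - 1) * expR (- x) / gamma_fun a else 0.

Definition logarithmic_pmf (theta : R) (n : nat) : R :=
  - (ln (1 - theta))^-1 * (theta ^+ n / n%:R).

(* The value at the single point 0 is immaterial for a density; it is set
   to 0. *)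
Definition log_sum_pdf (alpha beta theta : R) (x : R) : R :=
  if 0 < x then
    - (ln (1 - theta))^-1 *
    ((x * (1 + (1 - theta) * x / beta) `^ alpha)^-1 -
     (x * (1 + x / beta) `^ alpha)^-1)
  else 0.

End densities.

Section scaled_ratio.
Context d (T : measurableType d) (R : realType) (P : probability T R).

(* On the event [Z = 0] the quotient takes the junk value 0. *)
Definition scaled_ratio (b : R) (Y Z : {RV P >-> R}) (w : T) : R :=
  b * Y w / Z w.

Variables (b : R) (Y Z : {RV P >-> R}).

Let measurable_scaled_ratio : measurable_fun [set: T] (scaled_ratio b Y Z).
Proof.
rewrite (_ : scaled_ratio b Y Z =
    (fun w => (b * Y w) * (Z w * (Z w ^+ 2) `^ (-1)))); last first.
  apply/funext => w; rewrite /scaled_ratio powR_inv1 ?sqr_ge0//; congr (_ * _).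
  have [->|Z0] := eqVneq (Z w) 0; first by rewrite invr0 mul0r.
  by rewrite expr2 invfM mulrA divff// mul1r.
apply: measurable_funM; first exact: measurable_funM.
apply: measurable_funM => //.
apply: (measurableT_comp (measurable_powR (-1))).
exact: measurable_funX.
Qed.

HB.instance Definition _ :=
  isMeasurableFun.Build _ _ T R (scaled_ratio b Y Z) measurable_scaled_ratio.

End scaled_ratio.

Section random_sum.
Context d (T : measurableType d) (R : realType) (P : probability T R).

(* The family is indexed from 0: [X i] stands for the (i+1)-st summand, so that
   the sum is X_1 + ... + X_N. *)
Definition random_sum (X : nat -> {RV P >-> R}) (N : {RV P >-> nat})
    (w : T) : R :=
  \sum_(i < N w) X i w.

Variables (X : nat -> {RV P >-> R}) (N : {RV P >-> nat}).

Let measurable_random_sum : measurable_fun [set: T] (random_sum X N).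
Proof.
move=> _ A mA; rewrite setTI.
rewrite (_ : _ @^-1` A = \bigcup_n
    ((N @^-1` [set n]) `&` ((fun w => \sum_(i < n) X i w) @^-1` A))).
  apply: bigcupT_measurable => n; apply: measurableI.
    by rewrite -[X in measurable X]setTI; exact: measurable_funP.
  rewrite -[X in measurable X]setTI.
  suff : measurable_fun [set: T] (fun w => \sum_(i < n) X i w) by apply.
  by apply: measurable_sum => i; exact: measurable_funP.
apply/seteqP; split=> [w /= Aw|w [n _ [/= <-]]//].
by exists (N w).
Qed.

HB.instance Definition _ :=
  isMeasurableFun.Build _ _ T R (random_sum X N) measurable_random_sum.

End random_sum.

(* Main.v *)
(* Condition on [Y_alpha = y].  The partial sums of the [Y_i] have Erlang laws,
   and summing the Erlang densities against the logarithmic weights produces an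
   exponential series: [Y_1 + ... + Y_N] has density
   [c / x * (exp (- (1 - theta) x) - exp (- x))] with [c = - 1 / ln (1 - theta)].
   Rescaling by [beta / y], exchanging the integrals and using the Laplace
   transform [(1 + s) ^ - alpha] of the gamma law gives the claimed density.  The
   value of [Gamma (alpha)] is never needed: the Laplace transform comes from the
   rescaling [y -> (1 + s) y] and the fact that the density has total mass one.
*)
Require Import Defs.
From HB Require Import structures.
From mathcomp Require Import all_boot all_order all_algebra.
From mathcomp Require Import all_classical all_reals all_analysis.
From mathcomp Require Import measurable_realfun finmap ring lra.

Set Implicit Arguments.
Unset Strict Implicit.

Import Order.TTheory GRing.Theory Num.Def Num.Theory.
Import numFieldNormedType.Exports.

Local Open Scope classical_set_scope.
Local Open Scope ring_scope.

(** * Integration against a density, and affine substitution *)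

Section density.
Context d (T : measurableType d) (R : realType).
Local Open Scope ereal_scope.
Import HBNNSimple.

(** Simple functions increase to [f], so monotone convergence on both sides reduces the claim to
    indicators of level sets, where it is the hypothesis on [nu]. *)
Lemma ge0_integral_density (mu nu : {measure set T -> \bar R}) (g : T -> R)
    (f : T -> \bar R) :
  measurable_fun [set: T] g -> (forall x, (0 <= g x)%R) ->
  (forall A, measurable A -> nu A = \int[mu]_(x in A) (g x)%:E) ->
  measurable_fun [set: T] f -> (forall x, 0 <= f x) ->
  \int[nu]_x f x = \int[mu]_x (f x * (g x)%:E).
Proof.
move=> mg g0 nuE mf f0.
have mEg : measurable_fun [set: T] (EFin \o g) by exact/measurable_EFinP.
have Eg0 x : 0 <= (g x)%:E by rewrite lee_fin.
pose f_ := nnsfun_approx measurableT mf.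
transitivity (limn (fun n => \int[nu]_x (f_ n x)%:E)).
  rewrite -monotone_convergence//.
  - apply: eq_integral => y _; apply/esym/cvg_lim => //.
    exact: cvg_nnsfun_approx.
  - by move=> n; exact/measurable_EFinP.
  - by move=> n y _; rewrite lee_fin.
  - by move=> y _ m n mn; rewrite lee_fin; exact/lefP/nd_nnsfun_approx.
rewrite [X in limn X](_ : _ = (fun n => \int[mu]_x ((f_ n x)%:E * (g x)%:E))).
  rewrite -monotone_convergence//.
  - apply: eq_integral => y _; apply/cvg_lim => //.
    by apply: cvgeZr => //; exact: cvg_nnsfun_approx.
  - by move=> n; apply: emeasurable_funM => //; exact/measurable_EFinP.
  - by move=> n y _; rewrite mule_ge0// lee_fin.
  - move=> y _ m n mn; rewrite lee_wpmul2r// lee_fin.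
    exact/lefP/nd_nnsfun_approx.
apply/funext => n.
under eq_integral do rewrite fimfunE -fsumEFin//.
rewrite ge0_integral_fsum//; last 2 first.
- by move=> y; exact/measurable_EFinP/measurable_funM.
- by move=> y x _; rewrite nnfun_muleindic_ge0.
under [RHS]eq_integral.
  move=> x _; rewrite fimfunE -fsumEFin// ge0_mule_fsuml; last first.
    by move=> r; rewrite EFinM nnfun_muleindic_ge0.
  over.
rewrite [RHS]ge0_integral_fsum//; last 2 first.
- by move=> r; apply: emeasurable_funM => //; exact/measurable_EFinP/measurable_funM.
- by move=> r x _; rewrite mule_ge0// EFinM nnfun_muleindic_ge0.
apply: eq_fsbigr => r _; rewrite integralZl_indic_nnsfun// integral_indic// setIT.
have mr : measurable (f_ n @^-1` [set r]) by [].
(* A negative [r] has an empty level set because the approximants are nonnegative; both sides then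
   vanish. *)
rewrite nuE//; have [r0|r0] := leP 0%R r; last first.
  rewrite preimage_nnfun0// integral_set0 mule0 integral0_eq// => x _.
  by rewrite indicE in_set0 mulr0 mul0e.
rewrite integral_mkcond -ge0_integralZl//; last 2 first.
- by apply/(measurable_restrictT _ _).1 => //; exact: measurable_funTS.
- by move=> x _; exact: erestrict_ge0.
apply: eq_integral => x _; rewrite patchE indicE.
by case: ifPn => _; rewrite ?mulr1 ?mulr0 ?mule0 ?mul0e.
Qed.

End density.

(* [R] and [measurableTypeR R] have the same measurable sets but different
   displays; transporting along the identity reconciles them. *)
Lemma ge0_integral_lebesgue_density (R : realType)
    (nu : {measure set R -> \bar R}) (g : R -> R) (f : R -> \bar R) :
  measurable_fun [set: R] g -> (forall x, 0 <= g x) ->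
  (forall A, measurable A ->
    nu A = (\int[lebesgue_measure]_(x in A) (g x)%:E)%E) ->
  measurable_fun [set: R] f -> (forall x, 0 <= f x)%E ->
  (\int[nu]_x f x = \int[lebesgue_measure]_x (f x * (g x)%:E))%E.
Proof.
move=> mg g0 nuE mf f0.
have mid : measurable_fun [set: R] (idfun : R -> measurableTypeR R).
  by move=> _ A mA; rewrite setTI.
pose nu0 : {measure set (measurableTypeR R) -> \bar R} :=
  pushforward nu (idfun : R -> measurableTypeR R).
pose nu' := nu0 mid.
rewrite -(@ge0_integral_density _ _ _ lebesgue_measure nu' g f)//.
by rewrite (ge0_integral_pushforward mid nu).
Qed.

Section affine_change_of_variable.
Context {R : realType}.
Local Notation mu := (@lebesgue_measure R).
Local Open Scope ereal_scope.

(** Lebesgue measure is [a] times its own image under [x -> a x + b]. By uniqueness this need only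
    be checked on half-open intervals. *)
Lemma ge0_integral_affine (a b : R) (f : R -> \bar R) : (0 < a)%R ->
  measurable_fun [set: R] f -> (forall x, 0 <= f x) ->
  \int[mu]_x f x = a%:E * \int[mu]_x f (a * x + b)%R.
Proof.
move=> a0 mf f0.
pose phi : measurableTypeR R -> measurableTypeR R := fun x => (a * x + b)%R.
have mphi : measurable_fun [set: measurableTypeR R] phi.
  by apply: measurable_funD => //; exact: measurable_funM.
have a0' : (0 <= a)%R := ltW a0.
pose k : {nonneg R} := NngNum a0'.
pose phi' : {mfun measurableTypeR R >-> measurableTypeR R} :=
  HB.pack phi (isMeasurableFun.Build _ _ _ _ phi mphi).
have muE A : measurable A -> mu A = mscale k (pushforward mu phi') A.
  apply: lebesgue_measure_unique => _ [[u v] _ <-] /=.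
  rewrite /mscale/= /pushforward.
  rewrite (_ : phi @^-1` _ = `]((u - b) / a)%R, ((v - b) / a)%R]%classic); last first.
    apply/seteqP; split => x /=;
      by rewrite !in_itv/= /phi ltr_pdivrMr// ler_pdivlMr// ltrBlDr lerBrDr (mulrC a).
  rewrite !lebesgue_measure_itv/= !lte_fin ltr_pM2r ?invr_gt0// ltrD2r.
  case: ifPn => _; last by rewrite mule0.
  by rewrite -!EFinB -EFinM; congr EFin; field; rewrite gt_eqF.
rewrite (eq_measure_integral (mscale k (pushforward mu phi'))); last first.
  by move=> A mA _; exact: muE.
rewrite ge0_integral_mscale//; congr (_ * _).
by rewrite ge0_integral_pushforward.
Qed.

End affine_change_of_variable.

Lemma measurable_invr (R : realType) :
  measurable_fun [set: R] (GRing.inv : R -> R).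
Proof.
rewrite (_ : GRing.inv = fun x : R => x * (x ^+ 2) `^ (-1)); last first.
  apply/funext => x; rewrite powR_inv1 ?sqr_ge0//.
  have [->|x0] := eqVneq x 0; first by rewrite invr0 mul0r.
  by rewrite expr2 invfM mulrA divff// mul1r.
apply: measurable_funM => //.
by apply: (measurableT_comp (measurable_powR (-1))); exact: measurable_funX.
Qed.

(** * Joint laws and partial sums of independent variables *)

(** Passes from rectangles to all measurable sets by uniqueness of the product measure. The extra
    event [E] is carried along so that a function of the pair, such as its sum, can be shown
    independent of [E]. *)
Lemma independent_pair_law d (T : measurableType d) (R : realType)
    (P : probability T R) d1 (T1 : measurableType d1)
    d2 (T2 : measurableType d2) (U : {RV P >-> T1}) (V : {RV P >-> T2})
    (E : set T) : measurable E ->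
  (forall A B, measurable A -> measurable B ->
    P (E `&` (U @^-1` A `&` V @^-1` B)) =
    (P E * (P (U @^-1` A) * P (V @^-1` B)))%E) ->
  forall D, measurable D ->
    P (E `&` (fun w => (U w, V w)) @^-1` D) =
    (P E * (distribution P U \x distribution P V) D)%E.
Proof.
move=> mE indep D mD.
pose UV w := (U w, V w).
have mUV : measurable_fun [set: T] UV by exact: measurable_fun_pair.
have mUVD : measurable (UV @^-1` D) by rewrite -[X in measurable X]setTI; exact: mUV.
(* A null [E] makes both sides zero; otherwise one may divide by [P E]. *)
have [PE0|PE0] := eqVneq (P E) 0%E.
  rewrite PE0 mul0e; apply/eqP; rewrite -measure_le0 -PE0.
  by apply: le_measure => //; apply/mem_set => //; exact: measurableI.
have PEE : P E = (fine (P E))%:E by rewrite fineK// fin_num_measure.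
have PE_gt0 : 0 < fine (P E).
  by rewrite -lte_fin -PEE lt0e PE0 measure_ge0.
have PEV_ge0 : 0 <= (fine (P E))^-1 by rewrite invr_ge0 ltW.
(* The conditional law of [(U, V)] given [E]; on rectangles it agrees with the product of the
   marginals. *)
pose m0 := mscale (NngNum PEV_ge0) (pushforward (mrestr P mE) UV).
pose m' : {measure set (T1 * T2) -> \bar R} := m0 mUV.
have m'E X : m' X = ((fine (P E))^-1%:E * P (E `&` UV @^-1` X))%E.
  by rewrite /m'/= /mscale/= /pushforward/= /mrestr setIC.
have VPE x : ((fine (P E))^-1%:E * (P E * x) = x)%E.
  by rewrite muleA PEE -EFinM mulVf ?mul1e// gt_eqF.
rewrite (@product_measure_unique _ _ _ _ _ (distribution P U)
  (distribution P V) m')//.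
  by rewrite m'E [in RHS]PEE muleA -EFinM divff ?mul1e// gt_eqF.
move=> A B mA mB; rewrite m'E.
by rewrite (_ : UV @^-1` _ = U @^-1` A `&` V @^-1` B)// indep.
Qed.

Lemma random_sum_cstS d (T : measurableType d) (R : realType)
    (P : probability T R) (X : nat -> {RV P >-> R}) n w :
  random_sum X (cst n.+1) w = random_sum X (cst n) w + X n w.
Proof. by rewrite /random_sum big_ord_recr. Qed.

Section independent_partial_sum.
Context d (T : measurableType d) (R : realType) (P : probability T R).
Context (I : choiceType) (Z : I -> {RV P >-> R}) (s : nat -> I).
Hypothesis s_inj : injective s.
Hypothesis indepZ : mutually_independent_RV P Z.

Local Notation S n :=
  (random_sum (fun i => Z (s i)) (cst n) : {RV P >-> R}).

Let measurable_cylinder (J : {fset I}) (A : I -> set R) :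
  (forall i, measurable (A i)) -> measurable (\bigcap_(i in [set` J]) (Z i @^-1` A i)).
Proof.
move=> mA; apply: fin_bigcap_measurable => // i _.
by rewrite -[X in measurable X]setTI; exact: measurable_funP.
Qed.

(** Induction on [n] with [J] general: the last summand [Z (s n)] is moved into the cylinder, which
    leaves the shorter sum [S n] for the induction hypothesis. *)
Lemma independent_partial_sum_cylinder n (J : {fset I}) (A : I -> set R)
    (B : set R) : (forall i, measurable (A i)) -> measurable B ->
  (forall i, (i < n)%N -> s i \notin J) ->
  P (\bigcap_(i in [set` J]) (Z i @^-1` A i) `&` S n @^-1` B) =
  (P (\bigcap_(i in [set` J]) (Z i @^-1` A i)) * P (S n @^-1` B))%E.
Proof.
elim: n J A B => [|n IHn] J A B mA mB sJ.
  have [B0|B0] := pselect (B 0).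
    rewrite (_ : S 0%N @^-1` B = setT) ?probability_setT ?mule1 ?setIT//.
    by apply/seteqP; split => // w _; rewrite /= /random_sum big_ord0.
  rewrite (_ : S 0%N @^-1` B = set0) ?measure0 ?mule0 ?setI0 ?measure0//.
  by apply/seteqP; split => // w; rewrite /= /random_sum big_ord0.
pose sum_in := (fun p : R * R => p.1 + p.2) @^-1` B.
have msum_in : measurable sum_in.
  rewrite -[X in measurable X]setTI.
  suff : measurable_fun [set: R * R] (fun p : R * R => p.1 + p.2) by exact.
  exact: measurable_funD.
have SE : S n.+1 @^-1` B = (fun w => (S n w, Z (s n) w)) @^-1` sum_in.
  by apply/seteqP; split => w; rewrite /sum_in/= random_sum_cstS.
(* The cylinder, [S n] and [Z (s n)] factorise together on rectangles. The family [A'] is [A] with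
   the constraint at [s n] replaced by [B1], so the induction hypothesis applies to the index set
   [K] enlarged by [s n]. *)
have joint (K : {fset I}) : (forall i, (i < n.+1)%N -> s i \notin K) ->
    forall A1 B1, measurable A1 -> measurable B1 ->
    P (\bigcap_(i in [set` K]) (Z i @^-1` A i) `&`
       (S n @^-1` A1 `&` Z (s n) @^-1` B1)) =
    (P (\bigcap_(i in [set` K]) (Z i @^-1` A i)) *
      (P (S n @^-1` A1) * P (Z (s n) @^-1` B1)))%E.
  move=> sK A1 B1 mA1 mB1.
  pose A' i := if i == s n then B1 else A i.
  have A'E i : i \in K -> A' i = A i.
    by move=> iK; rewrite /A'; case: eqP iK => // ->; rewrite (negbTE (sK _ _)).
  have mA' i : measurable (A' i) by rewrite /A'; case: ifP.
  have capE : \bigcap_(i in [set` (s n |` K)%fset]) (Z i @^-1` A' i) =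
      \bigcap_(i in [set` K]) (Z i @^-1` A i) `&` Z (s n) @^-1` B1.
    apply/seteqP; split => [w h|w [h1 h2] i /=].
      split; first by move=> i iK; rewrite -(A'E i iK); apply: h; rewrite /= !inE iK orbT.
      by have := h (s n); rewrite /= /A' eqxx; apply; rewrite !inE eqxx.
    rewrite !inE => /predU1P[->|iK]; first by rewrite /A' eqxx.
    by rewrite A'E//; exact: h1.
  rewrite (setIC (S n @^-1` A1)) setIA -capE IHn//; last first.
    move=> i ni; rewrite !inE negb_or sK ?andbT//; last exact: ltnW.
    by apply/eqP => /s_inj iE; rewrite iE ltnn in ni.
  rewrite indepZ// big_fsetU1/= ?sK// {1}/A' eqxx.
  rewrite (eq_big_seq (fun i => P (Z i @^-1` A i))); last first.
    by move=> i iK; rewrite A'E.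
  by rewrite -indepZ// muleC [RHS]muleCA (muleC (P (Z (s n) @^-1` B1))).
have sum_law (K : {fset I}) : (forall i, (i < n.+1)%N -> s i \notin K) ->
    P (\bigcap_(i in [set` K]) (Z i @^-1` A i) `&` S n.+1 @^-1` B) =
    (P (\bigcap_(i in [set` K]) (Z i @^-1` A i)) *
      (distribution P (S n) \x distribution P (Z (s n))) sum_in)%E.
  move=> sK; rewrite SE independent_pair_law//; first exact: measurable_cylinder.
  exact: joint.
rewrite sum_law//; congr (_ * _)%E.
(* With no constraint at all, [sum_law] identifies the remaining factor as the probability of the
   event on [S n.+1]. *)
have := sum_law fset0; rewrite set_fset0 bigcap_set0 setTI probability_setT mul1e.
by move=> ->.
Qed.

Lemma independent_partial_sum n j (A B : set R) :
  measurable A -> measurable B -> (forall i, (i < n)%N -> s i != j) ->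
  P (Z j @^-1` A `&` S n @^-1` B) = (P (Z j @^-1` A) * P (S n @^-1` B))%E.
Proof.
move=> mA mB sj.
have := @independent_partial_sum_cylinder n [fset j]%fset (fun=> A) B.
rewrite set_fset1 bigcap_set1; apply => // i ni.
by rewrite inE sj.
Qed.

End independent_partial_sum.

(** Conditioning on [U = x]: the product measure of [D] integrates the section masses against the
    law of [U], which is then replaced by its density. *)
Lemma independent_pair_pdf d (T : measurableType d) (R : realType)
    (P : probability T R) d2 (T2 : measurableType d2)
    (U : {RV P >-> R}) (V : {RV P >-> T2}) (f : R -> R) : has_pdf P U f ->
  (forall A B, measurable A -> measurable B ->
    P (U @^-1` A `&` V @^-1` B) = (P (U @^-1` A) * P (V @^-1` B))%E) ->
  forall D, measurable D ->
    P ((fun w => (U w, V w)) @^-1` D) =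
    (\int[lebesgue_measure]_x (P (V @^-1` xsection D x) * (f x)%:E))%E.
Proof.
move=> [mf f0 fE] indep D mD.
rewrite -[in LHS](setTI (_ @^-1` D)) independent_pair_law//; last first.
  by move=> A B mA mB; rewrite setTI probability_setT mul1e; exact: indep.
rewrite probability_setT mul1e.
rewrite /product_measure1.
rewrite (@ge0_integral_lebesgue_density _ (distribution P U) f)//.
exact: measurable_fun_xsection.
Qed.

(** * Erlang densities as laws of sums of standard exponentials *)

Section erlang.
Context {R : realType}.
Local Notation mu := (@lebesgue_measure R).

(* Indexed so that it is the density of the sum of [n.+1] standard exponential
   variables. *)
Definition erlang_pdf (n : nat) (x : R) : R :=
  if 0 < x then x ^+ n / n`!%:R * expR (- x) else 0.

Lemma erlang_pdf_ge0 n x : 0 <= erlang_pdf n x.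
Proof.
rewrite /erlang_pdf; case: ifPn => // x0.
by rewrite mulr_ge0 ?expR_ge0// divr_ge0// exprn_ge0// ltW.
Qed.

Lemma measurable_erlang_pdf n : measurable_fun [set: R] (erlang_pdf n).
Proof.
apply: measurable_fun_if => //=; first exact: measurable_fun_ltr.
apply: measurable_funTS; apply: measurable_funM.
  by apply: measurable_funM => //; exact: measurable_funX.
by apply: measurableT_comp => //; exact: measurable_funN.
Qed.

Lemma integral_expR_oppr : (\int[mu]_(x in `]0%R, +oo[) (expR (- x))%:E = 1)%E.
Proof.
rewrite -(@integral_exponential_pdf R 1)//.
rewrite integral_itv_obnd_cbnd; last first.
  apply/measurable_EFinP; apply: measurable_funTS.
  by apply: measurableT_comp => //; exact: measurable_funN.
rewrite integral_mkcond; apply: eq_integral => x _.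
rewrite /exponential_pdf !patchE; case: ifPn => // _.
by rewrite mulN1r mul1r.
Qed.

(** Starts the Erlang recursion; the content is that Gamma takes the value 1 at 1. *)
Lemma gamma_pdf1E : gamma_pdf 1 = erlang_pdf 0 :> (R -> R).
Proof.
apply/funext => x; rewrite /gamma_pdf /erlang_pdf; case: ifPn => // x0.
have -> : gamma_fun 1 = 1 :> R.
  rewrite /gamma_fun subrr /Rintegral.
  under eq_integral do rewrite powRr0 mul1r.
  by rewrite integral_expR_oppr.
by rewrite subrr powRr0 expr0 fact0 !divr1.
Qed.

(** Serves twice: in the Erlang convolution, and to write the weights [theta ^+ n.+1 / n.+1] as
    integrals. *)
Lemma integral_exprn n (z : R) : 0 < z ->
  (\int[mu]_(x in `]0%R, z[) (x ^+ n)%:E = (z ^+ n.+1 / n.+1%:R)%:E)%E.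
Proof.
move=> z0.
have cX m : continuous (fun x : R => x ^+ m) by exact: exprn_continuous.
have dF (x : R) : is_derive x 1 (fun x : R => x ^+ n.+1 / n.+1%:R) (x ^+ n).
  rewrite (_ : (fun x : R => _) = n.+1%:R^-1 \*: (id ^+ n.+1)); last first.
    by apply/funext => y; rewrite /= mulrC exprfctE.
  apply: is_derive_eq; rewrite /GRing.scale/= mulr1.
  by rewrite mulrA mulVf ?pnatr_eq0// mul1r.
rewrite -(@integral_itv_bndoo _ _ _ _ true false); last first.
  by apply/measurable_EFinP; apply: measurable_funTS; exact: measurable_funX.
rewrite (@continuous_FTC2 _ _ (fun x => x ^+ n.+1 / n.+1%:R))//.
- by rewrite expr0n/= mul0r sube0.
- exact: continuous_subspaceT.
- split.
  + by move=> x _; exact: ex_derive.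
  + by apply: cvg_at_right_filter; apply: cvgM; [exact: cX|exact: cvg_cst].
  + by apply: cvg_at_left_filter; apply: cvgM; [exact: cX|exact: cvg_cst].
- by move=> x _; rewrite derive1E; exact: derive_val.
Qed.

(** On [0 < x < z] the two exponentials multiply to [expR (- z)], independent of [x], so only the
    integral of [x ^+ n] remains. *)
Lemma integral_erlang_convolution n (z : R) :
  (\int[mu]_x (erlang_pdf n x * erlang_pdf 0 (z - x))%:E =
   (erlang_pdf n.+1 z)%:E)%E.
Proof.
rewrite {3}/erlang_pdf; case: ifPn => z0; last first.
  rewrite integral0_eq// => x _; rewrite /erlang_pdf; case: ifPn => x0; last first.
    by rewrite mul0r.
  (* For [z <= 0], the arguments [x] and [z - x] cannot both be positive. *)
  by rewrite ifF ?mulr0//; apply/negbTE; move: z0 x0; rewrite -!leNgt; lra.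
rewrite (_ : z ^+ n.+1 / _ * _ = z ^+ n.+1 / n.+1%:R * (expR (- z) / n`!%:R));
  last by rewrite factS natrM invfM; ring.
rewrite EFinM -integral_exprn// -ge0_integralZr//; last 2 first.
- by apply/measurable_EFinP; apply: measurable_funTS; exact: measurable_funX.
- by move=> x /=; rewrite in_itv/= => /andP[/ltW x0 _]; rewrite lee_fin exprn_ge0.
rewrite [RHS]integral_mkcond; apply: eq_integral => x _.
rewrite patchE; case: ifPn => [/set_mem/=|].
  rewrite in_itv/= => /andP[x0 xz].
  rewrite /erlang_pdf x0 subr_gt0 xz expr0 fact0 divr1 mul1r.
  have -> : expR (- z) = expR (- x) * expR (- (z - x)).
    by rewrite -expRD; congr expR; lra.
  by rewrite -EFinM; congr EFin; ring.
rewrite notin_setE/= in_itv/= => /negP.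
rewrite negb_and => /orP[] h; rewrite /erlang_pdf.
  by rewrite (negbTE h) mul0r.
by rewrite subr_gt0 (negbTE h) mulr0.
Qed.

End erlang.

Section erlang_sum.
Context d (T : measurableType d) (R : realType) (P : probability T R).
Context (I : choiceType) (Z : I -> {RV P >-> R}) (s : nat -> I).
Hypothesis s_inj : injective s.
Hypothesis indepZ : mutually_independent_RV P Z.
Hypothesis pdfZ : forall n, has_pdf P (Z (s n)) (gamma_pdf 1).
Local Notation mu := (@lebesgue_measure R).
Local Notation S n :=
  (random_sum (fun i => Z (s i)) (cst n) : {RV P >-> R}).

(** Induction on [n]: condition on the sum so far, use the exponential density of the next variable,
    and exchange the integrals to reach the convolution. *)
Lemma erlang_partial_sum n : has_pdf P (S n.+1) (erlang_pdf n).
Proof.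
split; [exact: measurable_erlang_pdf|exact: erlang_pdf_ge0|].
elim: n => [|n IHn] B mB.
  rewrite -gamma_pdf1E; have [_ _ <- //] := pdfZ 0.
  rewrite /distribution /pushforward; congr (P _); apply/seteqP.
  by split => w; rewrite /= /random_sum/= big_ord1.
pose sum_in := (fun p : R * R => p.1 + p.2) @^-1` B.
have msum_in : measurable sum_in.
  rewrite -[X in measurable X]setTI.
  suff : measurable_fun [set: R * R] (fun p : R * R => p.1 + p.2) by exact.
  exact: measurable_funD.
have Sn_pdf : has_pdf P (S n.+1) (erlang_pdf n).
  by split; [exact: measurable_erlang_pdf|exact: erlang_pdf_ge0|].
rewrite (_ : distribution P _ B =
    P ((fun w => (S n.+1 w, Z (s n.+1) w)) @^-1` sum_in)); last first.
  rewrite /distribution /pushforward; congr (P _); apply/seteqP.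
  by split => w; rewrite /sum_in/= (random_sum_cstS _ n.+1).
rewrite (independent_pair_pdf Sn_pdf)//; last first.
  move=> A1 B1 mA1 mB1; rewrite setIC independent_partial_sum//; first by rewrite muleC.
  by move=> i ni; apply/eqP => /s_inj iE; rewrite iE ltnn in ni.
have mi1 : measurable_fun [set: R * R]
    (fun p : R * R => (\1_B p.2 * (erlang_pdf n p.1 * erlang_pdf 0 (p.2 - p.1)))%:E).
  apply/measurable_EFinP; apply: measurable_funM.
    by apply: measurableT_comp => //; exact: measurable_indic.
  apply: measurable_funM.
    by apply: measurableT_comp => //; exact: measurable_erlang_pdf.
  apply: (measurableT_comp (measurable_erlang_pdf 0)).
  by apply: measurable_funB.
have i0 (p : R * R) :
    (0 <= (\1_B p.2 * (erlang_pdf n p.1 * erlang_pdf 0 (p.2 - p.1)))%:E)%E.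
  by rewrite lee_fin mulr_ge0// mulr_ge0 ?erlang_pdf_ge0.
transitivity (\int[mu]_x \int[mu]_z
    (\1_B z * (erlang_pdf n x * erlang_pdf 0 (z - x)))%:E)%E.
  apply: eq_integral => x _.
  have [_ _ ZE] := pdfZ n.+1.
  rewrite -[P _]/(distribution P (Z (s n.+1)) (xsection sum_in x)) ZE; last first.
    exact: measurable_xsection.
  rewrite gamma_pdf1E integral_mkcond.
  pose g : R -> \bar R := (fun y => (erlang_pdf 0 y)%:E) \_ (xsection sum_in x).
  rewrite -[X in (X * _)%E]/(\int[mu]_y g y)%E.
  have mg : measurable_fun [set: R] g.
    apply/(measurable_restrictT _ _).1; first exact: measurable_xsection.
    by apply: measurable_funTS; apply/measurable_EFinP; exact: measurable_erlang_pdf.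
  have g0 y : (0 <= g y)%E.
    by apply: erestrict_ge0 => {}y _; rewrite lee_fin erlang_pdf_ge0.
  (* Substitutes [y = z - x], where [z] is the value of the new sum; the section constraint on [y]
     becomes [z \in B], free of [x]. *)
  rewrite (@ge0_integral_affine _ 1 (- x))// mul1e -ge0_integralZr//; last 2 first.
  - apply: (measurableT_comp mg).
    by apply: measurable_funD => //; exact: measurable_funM.
  - by rewrite lee_fin erlang_pdf_ge0.
  apply: eq_integral => z _; rewrite /g patchE mul1r.
  have -> : (z - x \in xsection sum_in x) = (z \in B).
    by rewrite mem_xsection; apply: asbool_equiv_eq; rewrite /sum_in/= addrC subrK.
  rewrite indicE; case: (z \in B); last by rewrite mul0e mul0r.
  by rewrite mul1r -EFinM mulrC.
rewrite (@fubini_tonelli _ _ _ _ _ mu mu (fun p : R * R =>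
  (\1_B p.2 * (erlang_pdf n p.1 * erlang_pdf 0 (p.2 - p.1)))%:E))//=.
rewrite [RHS]integral_mkcond; apply: eq_integral => z _.
rewrite patchE indicE; case: ifPn => zB.
  rewrite -integral_erlang_convolution.
  by apply: eq_integral => x _; rewrite mul1r.
by rewrite integral0_eq// => x _; rewrite mul0r.
Qed.

End erlang_sum.

Lemma nneseries_EFin (R : realType) (u : nat -> R) (l : R) :
  series u @ \oo --> l -> (\sum_(n <oo) (u n)%:E = l%:E)%E.
Proof.
move=> ul; rewrite -(cvg_lim _ ul)// -EFin_lim; last by apply/cvg_ex; exists l.
by apply/congr_lim/funext => n /=; rewrite sumEFin.
Qed.

(** * Logarithmic weights and the mixture of Erlang densities *)

Section logarithmic.
Context {R : realType} (theta : R).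
Hypothesis theta01 : 0 < theta < 1.
Local Notation mu := (@lebesgue_measure R).

Let theta_gt0 : 0 < theta. Proof. by case/andP: theta01. Qed.
Let theta_lt1 : theta < 1. Proof. by case/andP: theta01. Qed.

Lemma ln_onem_lt0 : ln (1 - theta) < 0.
Proof. by rewrite ln_lt0// subr_gt0 theta_lt1/= gtrBl. Qed.

Lemma logarithmic_pmf_ge0 n : 0 <= logarithmic_pmf theta n.
Proof.
rewrite mulr_ge0//; first by rewrite oppr_ge0 invr_le0 ltW// ln_onem_lt0.
by rewrite divr_ge0// exprn_ge0// ltW.
Qed.

Lemma integral_inv_onem :
  (\int[mu]_(x in `]0%R, theta[) ((1 - x)^-1)%:E = (- ln (1 - theta))%:E)%E.
Proof.
have dF (x : R) : x < 1 -> is_derive x 1 (fun x : R => - ln (1 - x)) (1 - x)^-1.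
  move=> x1; have x10 : 0 < 1 - x by rewrite subr_gt0.
  have dln := is_derive1_ln x10.
  have d1 : is_derive x 1 (fun x : R => 1 - x) (-1).
    by apply: is_derive_eq; rewrite add0r mul1r.
  have := is_deriveN (@is_derive1_comp _ (@ln R) (fun x : R => 1 - x) x _ _ dln d1).
  by rewrite mulrN1 opprK.
have cF (x : R) : x < 1 -> {for x, continuous (fun x : R => - ln (1 - x))}.
  move=> /dF x1; apply: differentiable_continuous.
  by apply/derivable1_diffP; exact: ex_derive.
have cinv (x : R) : x < 1 -> {for x, continuous (fun x : R => (1 - x)^-1)}.
  move=> x1; apply: cvgV; first by rewrite gt_eqF// subr_gt0.
  by apply: cvgB; [exact: cvg_cst|exact: cvg_id].
rewrite -(@integral_itv_bndoo _ _ _ _ true false); last first.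
  apply/measurable_EFinP; apply: open_continuous_measurable_fun => //.
  move=> x /set_mem/=; rewrite in_itv/= => /andP[_ /lt_trans/(_ theta_lt1)].
  exact: cinv.
rewrite (@continuous_FTC2 _ _ (fun x => - ln (1 - x)))//.
- by rewrite subr0 ln1 oppr0 sube0.
- apply: continuous_in_subspaceT => x /set_mem/=; rewrite in_itv/=.
  by move=> /andP[_ /le_lt_trans/(_ theta_lt1)]; exact: cinv.
- split.
  + by move=> x /[!in_itv]/= /andP[_ /lt_trans/(_ theta_lt1)] /dF x1; exact: ex_derive.
  + by apply: cvg_at_right_filter; apply: cF.
  + by apply: cvg_at_left_filter; apply: cF.
- move=> x /[!in_itv]/= /andP[_ /lt_trans/(_ theta_lt1)] /dF x1.
  by rewrite derive1E; exact: derive_val.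
Qed.

(** Each [theta ^+ n.+1 / n.+1] is the integral of [x ^+ n] over []0, theta[]. Exchanging sum and
    integral leaves the geometric series, and [(1 - x)^-1] integrates to [- ln (1 - theta)]. *)
Lemma sum_logarithmic_pmf :
  (\sum_(n <oo) (logarithmic_pmf theta n.+1)%:E = 1)%E.
Proof.
transitivity (\sum_(n <oo) ((- (ln (1 - theta))^-1)%:E *
    \int[mu]_(x in `]0%R, theta[) (x ^+ n)%:E))%E.
  by apply: eq_eseriesr => n _; rewrite integral_exprn// -EFinM.
rewrite nneseriesZl; last first.
  move=> n _; apply: integral_ge0 => x /=; rewrite in_itv/= => /andP[/ltW x0 _].
  by rewrite lee_fin exprn_ge0.
rewrite -integral_nneseries//; last 2 first.
- by move=> n; apply/measurable_EFinP; apply: measurable_funTS; exact: measurable_funX.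
- move=> n x /=; rewrite in_itv/= => /andP[/ltW x0 _].
  by rewrite lee_fin exprn_ge0.
transitivity ((- (ln (1 - theta))^-1)%:E *
    \int[mu]_(x in `]0%R, theta[) ((1 - x)^-1)%:E)%E.
  congr (_ * _)%E; apply: eq_integral => x /set_mem/=.
  rewrite in_itv/= => /andP[x0 xt].
  apply: nneseries_EFin; rewrite -(mul1r (1 - x)^-1).
  have <- : geometric 1 x = @GRing.exp R x.
    by apply/funext => n; rewrite /geometric/= mul1r.
  by apply: cvg_geometric_series; rewrite gtr0_norm// (lt_trans xt).
by rewrite integral_inv_onem -EFinM mulrNN mulVf// lt_eqF// ln_onem_lt0.
Qed.

Definition erlang_mixture (x : R) : R :=
  if 0 < x then
    - (ln (1 - theta))^-1 / x * (expR (- ((1 - theta) * x)) - expR (- x))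
  else 0.

Lemma erlang_mixture_ge0 x : 0 <= erlang_mixture x.
Proof.
rewrite /erlang_mixture; case: ifPn => // x0.
rewrite !mulr_ge0 ?invr_ge0 ?(ltW x0)//.
  by rewrite oppr_ge0 invr_le0 ltW// ln_onem_lt0.
by rewrite subr_ge0 ler_expR lerN2 ler_piMl ?(ltW x0)// gerBl ltW.
Qed.

Lemma measurable_erlang_mixture : measurable_fun [set: R] erlang_mixture.
Proof.
have mexp (a : R) : measurable_fun [set: R] (fun x : R => expR (- (a * x))).
  by apply: measurableT_comp => //; apply: measurable_funN; exact: measurable_funM.
apply: measurable_fun_if => //=; first exact: measurable_fun_ltr.
apply: measurable_funM.
  by apply: measurable_funM => //; apply: measurable_funTS; exact: measurable_invr.
apply: measurable_funTS; apply: measurable_funB; first exact: mexp.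
by apply: measurableT_comp => //; exact: measurable_funN.
Qed.

(** The [n.+1] in the weight completes the [n]! of the Erlang density to a factorial of [n.+1], so
    the terms are those of the exponential series at [theta * x], without its constant term. *)
Lemma sum_erlang_pdf (x : R) :
  (\sum_(n <oo) (logarithmic_pmf theta n.+1 * erlang_pdf n x)%:E =
   (erlang_mixture x)%:E)%E.
Proof.
rewrite /erlang_mixture /erlang_pdf; case: ifPn => x0; last first.
  by rewrite eseries0// => n _ _; rewrite mulr0.
apply: nneseries_EFin.
pose c := - (ln (1 - theta))^-1 / x * expR (- x).
(* The shift by one: [n] terms here match the first [n.+1] exponential terms minus the initial 1.
   The [1 / x] in [c] pays for raising [x ^+ n] to [x ^+ n.+1]. *)
rewrite (_ : series _ =
    (fun n => c * (series (exp_coeff (theta * x)) n.+1 - 1))); last first.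
  apply/funext => n; rewrite /series/= big_nat_recl//= /exp_coeff/=.
  rewrite expr0 fact0 divr1 addrAC subrr add0r mulr_sumr.
  apply: eq_bigr => i _; rewrite /logarithmic_pmf /c exprMn factS natrM !exprS.
  have : x != 0 by rewrite gt_eqF.
  have : i.+1%:R != 0 :> R by rewrite pnatr_eq0.
  have : i`!%:R != 0 :> R by rewrite pnatr_eq0 -lt0n fact_gt0.
  have : ln (1 - theta) != 0 by rewrite lt_eqF// ln_onem_lt0.
  by move=> h1 h2 h3 h4; field; rewrite h1 h2 h4 addrC natr1 h3.
rewrite [X in _ --> X](_ : _ = c * (expR (theta * x) - 1)); last first.
  rewrite (_ : expR (- ((1 - theta) * x)) = expR (- x) * expR (theta * x)).
    by rewrite /c; ring.
  by rewrite -expRD; congr expR; ring.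
apply: cvgM; first exact: cvg_cst.
apply: cvgB; last exact: cvg_cst.
rewrite (@cvg_shiftS _ (series (exp_coeff (theta * x)))).
exact: is_cvg_series_exp_coeff.
Qed.

End logarithmic.

(** * Laplace transform of the gamma law, and mixing over the denominator *)

Lemma gamma_pdf_laplace (R : realType) (alpha s : R) : 0 <= s ->
  measurable_fun [set: R] (gamma_pdf alpha) ->
  (forall y, 0 <= gamma_pdf alpha y) ->
  (\int[lebesgue_measure]_y (gamma_pdf alpha y)%:E = 1)%E ->
  (\int[lebesgue_measure]_y (gamma_pdf alpha y * expR (- (s * y)))%:E =
   ((1 + s) `^ alpha)^-1%:E)%E.
Proof.
move=> s0 mg g0 g1.
have a0 : 0 < 1 + s by rewrite ltr_wpDr.
have k0 : 0 < (1 + s) `^ (alpha - 1) by exact: powR_gt0.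
have mexp : measurable_fun [set: R] (fun y => expR (- (s * y))).
  by apply: measurableT_comp => //; apply: measurable_funN; exact: measurable_funM.
set I := (\int[_]_y _)%E.
(* Substitute [(1 + s) * y] in the total mass: the Jacobian gives one factor [1 + s], the power in
   the density gives [alpha - 1] more, and the exponential splits off [expR (- (s * y))]. The
   constant [gamma_fun alpha] is untouched. *)
have : (((1 + s) `^ alpha)%:E * I = 1)%E.
  rewrite -g1 [RHS](@ge0_integral_affine _ (1 + s) 0)//; last exact/measurable_EFinP.
  have -> : (1 + s) `^ alpha = (1 + s) * (1 + s) `^ (alpha - 1).
    rewrite -[X in X * _]powRr1 ?ltW// -powRD; first by congr (_ `^ _); ring.
    by rewrite (gt_eqF a0) implybT.
  rewrite EFinM -muleA; congr (_ * _)%E; rewrite /I -ge0_integralZl//; last 3 first.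
  - by apply/measurable_EFinP; exact: measurable_funM.
  - by move=> y _; rewrite lee_fin mulr_ge0// expR_ge0.
  - by rewrite lee_fin ltW.
  apply: eq_integral => y _; rewrite addr0 /gamma_pdf pmulr_rgt0//.
  case: ifPn => y0; last by rewrite mul0r mule0.
  rewrite powRM ?ltW// -EFinM; congr EFin.
  have -> : - ((1 + s) * y) = - y - s * y by ring.
  by rewrite expRD; ring.
move=> kI; have aa0 : (1 + s) `^ alpha != 0 by rewrite gt_eqF// powR_gt0.
by rewrite -[RHS]mule1 -kI muleA -EFinM mulVf// mul1e.
Qed.

Section mixture_kernel.
Context {R : realType} (alpha beta theta : R).
Hypothesis beta_gt0 : 0 < beta.
Hypothesis theta01 : 0 < theta < 1.
Local Notation mu := (@lebesgue_measure R).
Local Notation g := (gamma_pdf alpha).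
Local Notation h := (erlang_mixture theta).
Hypothesis mg : measurable_fun [set: R] g.
Hypothesis g0 : forall y, 0 <= g y.
Hypothesis g1 : (\int[mu]_y (g y)%:E = 1)%E.

(* The joint density of [Y_alpha] and [S_N]. *)
Definition mixture_kernel (y z : R) : R := g y * (y / beta * h (y / beta * z)).

Lemma mixture_kernel_ge0 y z : 0 <= mixture_kernel y z.
Proof.
rewrite /mixture_kernel; have [y0|y0] := ltP 0 y.
  by rewrite mulr_ge0// mulr_ge0 ?erlang_mixture_ge0// divr_ge0 ?ltW.
by rewrite /gamma_pdf ltNge y0 mul0r.
Qed.

Lemma measurable_mixture_kernel :
  measurable_fun [set: R * R] (fun p : R * R => mixture_kernel p.1 p.2).
Proof.
have my : measurable_fun [set: R * R] (fun p : R * R => p.1 / beta).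
  exact: measurable_funM.
apply: measurable_funM; first exact: (measurableT_comp mg).
apply: measurable_funM => //.
apply: (measurableT_comp (measurable_erlang_mixture theta)).
exact: measurable_funM.
Qed.

(** The factor [y / beta] cancels against the reciprocal of the argument of [h]. What remains is a
    constant times the difference of two Laplace integrands, at [s1] and [s2]. *)
Lemma integral_mixture_kernel z :
  (\int[mu]_y (mixture_kernel y z)%:E = (log_sum_pdf alpha beta theta z)%:E)%E.
Proof.
have /andP[th0 th1] := theta01.
rewrite /log_sum_pdf; case: ifPn => z0; last first.
  rewrite integral0_eq// => y _; rewrite /mixture_kernel.
  have [y0|y0] := ltP 0 y; last by rewrite /gamma_pdf ltNge y0 mul0r.
  by rewrite /erlang_mixture pmulr_rgt0 ?divr_gt0// (negbTE z0) !mulr0.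
pose c := - (ln (1 - theta))^-1 / z.
have c0 : 0 <= c.
  rewrite divr_ge0//; last exact: ltW.
  by rewrite oppr_ge0 invr_le0 ltW// ln_onem_lt0.
pose L (s y : R) := g y * expR (- (s * y)).
have mL s : measurable_fun [set: R] (EFin \o L s).
  apply/measurable_EFinP; apply: measurable_funM => //.
  by apply: measurableT_comp => //; apply: measurable_funN; exact: measurable_funM.
have L0 s y : 0 <= L s y by rewrite mulr_ge0// expR_ge0.
pose s1 := (1 - theta) * z / beta; pose s2 := z / beta.
have s1_ge0 : 0 <= s1 by rewrite divr_ge0 ?mulr_ge0// ?subr_ge0 ltW.
have s2_ge0 : 0 <= s2 by rewrite divr_ge0 ?ltW.
have KE y : mixture_kernel y z = c * (L s1 y - L s2 y).
  rewrite /mixture_kernel /L; have [y0|y0] := ltP 0 y; last first.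
    by rewrite /gamma_pdf ltNge y0 !mul0r subrr mulr0.
  rewrite /erlang_mixture pmulr_rgt0 ?divr_gt0// z0.
  rewrite (_ : (1 - theta) * (y / beta * z) = s1 * y); last by rewrite /s1; ring.
  rewrite (_ : y / beta * z = s2 * y); last by rewrite /s2; ring.
  rewrite /c /s2; field.
  have lnN0 : ln (1 - theta) != 0 by rewrite lt_eqF// ln_onem_lt0.
  by rewrite lnN0 (gt_eqF z0) (gt_eqF beta_gt0) ?(gt_eqF y0).
have s12 : s1 <= s2.
  by rewrite /s1 /s2 ler_pM2r ?invr_gt0// ler_piMl ?ltW// gtrBl.
have LB y : 0 <= L s1 y - L s2 y.
  rewrite -mulrBr; have [y0|y0] := ltP 0 y; last first.
    by rewrite /gamma_pdf ltNge y0 mul0r.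
  by rewrite mulr_ge0// subr_ge0 ler_expR lerN2 ler_pM2r.
have mLB : measurable_fun [set: R] (fun y => (L s1 y - L s2 y)%:E).
  by apply/measurable_EFinP; apply: measurable_funB; exact/measurable_EFinP.
(* The difference is integrated through a sum of nonnegative integrands; the second integral is
   finite by the Laplace formula and can then be subtracted. *)
have sumL : (\int[mu]_y (L s1 y - L s2 y)%:E + \int[mu]_y (L s2 y)%:E =
    \int[mu]_y (L s1 y)%:E)%E.
  rewrite -ge0_integralD//; last 3 first.
  - by move=> y _; rewrite lee_fin.
  - by move=> y _; rewrite lee_fin.
  - exact: mL.
  by apply: eq_integral => y _; rewrite -EFinD subrK.
under eq_integral do rewrite KE EFinM.
rewrite ge0_integralZl//; last by move=> y _; rewrite lee_fin.
move: sumL; rewrite !gamma_pdf_laplace//; set I := (\int[_]_y _)%E => sumL.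
have -> : I = (((1 + s1) `^ alpha)^-1%:E - ((1 + s2) `^ alpha)^-1%:E)%E.
  by rewrite -sumL addeK.
rewrite -EFinB -EFinM /c; congr EFin.
rewrite !invfM -/s1 -/s2.
ring.
Qed.

(** Nonnegativity, and measurability below, are inherited from the representation as a marginal of
    the kernel. *)
Lemma log_sum_pdf_ge0 z : 0 <= log_sum_pdf alpha beta theta z.
Proof.
rewrite -lee_fin -integral_mixture_kernel; apply: integral_ge0 => y _.
by rewrite lee_fin mixture_kernel_ge0.
Qed.

Lemma measurable_log_sum_pdf :
  measurable_fun [set: R] (log_sum_pdf alpha beta theta).
Proof.
apply/measurable_EFinP.
rewrite (_ : _ \o _ = fun z => (\int[mu]_y (mixture_kernel y z)%:E)%E); last first.
  by apply/funext => z; rewrite integral_mixture_kernel.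
apply: (@measurable_fun_fubini_tonelli_G _ _ _ _ _ mu
  (fun p : R * R => (mixture_kernel p.1 p.2)%:E)) => //.
- by apply/measurable_EFinP; exact: measurable_mixture_kernel.
- by move=> p; rewrite lee_fin mixture_kernel_ge0.
Qed.

(** The left side averages, over the value [y] of the denominator, the mass that the mixture gives
    to the rescaled [A]. Rescaling the inner variable and applying Tonelli turns it into the kernel
    integrated first in [y]. *)
Lemma integral_log_sum_pdf (A : set R) : measurable A ->
  (\int[mu]_y
     ((\int[mu]_(x in [set x | A (beta * x / y)%R]) (h x)%:E) * (g y)%:E) =
   \int[mu]_(z in A) (log_sum_pdf alpha beta theta z)%:E)%E.
Proof.
move=> mA.
pose f (p : R * R) := (\1_A p.2 * mixture_kernel p.1 p.2)%:E.
have mf : measurable_fun [set: R * R] f.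
  apply/measurable_EFinP; apply: measurable_funM; last exact: measurable_mixture_kernel.
  by apply: measurableT_comp => //; exact: measurable_indic.
have f0 p : (0 <= f p)%E by rewrite lee_fin mulr_ge0// mixture_kernel_ge0.
have mh : measurable_fun [set: R] (EFin \o h).
  by apply/measurable_EFinP; exact: measurable_erlang_mixture.
transitivity (\int[mu]_y \int[mu]_z f (y, z))%E.
  (* For [y <= 0] the gamma density vanishes, so the substitution [x = y / beta * z] is made only
     with a positive factor. *)
  apply: eq_integral => y _; have [y0|y0] := ltP 0 y; last first.
    rewrite /f /mixture_kernel /gamma_pdf/= ltNge y0 mule0 integral0_eq// => z _.
    by rewrite mul0r mulr0.
  have mD : measurable [set x | A (beta * x / y)].
    rewrite -[X in measurable X]setTI.
    suff : measurable_fun [set: R] (fun x : R => beta * x / y) by exact.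
    by apply: measurable_funM => //; exact: measurable_funM.
  rewrite integral_mkcond.
  pose u : R -> \bar R := (fun x => (h x)%:E) \_ [set x | A (beta * x / y)].
  rewrite -[X in (X * _)%E]/(\int[mu]_x u x)%E.
  have mu_ : measurable_fun [set: R] u.
    by apply/(measurable_restrictT _ _).1 => //; exact: measurable_funTS.
  have u0 x : (0 <= u x)%E.
    by apply: erestrict_ge0 => {}x _; rewrite lee_fin erlang_mixture_ge0.
  have yb0 : 0 < y / beta by rewrite divr_gt0.
  rewrite (@ge0_integral_affine _ (y / beta) 0)//.
  rewrite muleAC -EFinM -ge0_integralZl//; last 2 first.
  - apply: (measurableT_comp mu_).
    by apply: measurable_funD => //; exact: measurable_funM.
  - by rewrite lee_fin mulr_ge0// ltW.
  apply: eq_integral => z _; rewrite /f/= addr0 /u patchE indicE.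
  have -> : (y / beta * z \in [set x | A (beta * x / y)]) = (z \in A).
    apply: asbool_equiv_eq => /=.
    by have -> : beta * (y / beta * z) / y = z by field; rewrite !gt_eqF.
  case: (z \in A); last by rewrite mul0r mule0.
  by rewrite mul1r -EFinM /mixture_kernel; congr EFin; ring.
rewrite (@fubini_tonelli _ _ _ _ _ mu mu f)// [RHS]integral_mkcond.
apply: eq_integral => z _; rewrite patchE -integral_mixture_kernel /f/= indicE.
case: ifPn => zA; first by apply: eq_integral => y _; rewrite mul1r.
by rewrite integral0_eq// => y _; rewrite mul0r.
Qed.

End mixture_kernel.

(** * Decomposition along the random index *)

(** Makes the independence of [N] from the process applicable to fixed-length sums: each summand is
    measurable for the generated sigma-algebra, hence so is the sum. *)
Lemma sigma_of_process_partial_sum d (T : measurableType d) (R : realType)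
    (P : probability T R) (X : nat -> {RV P >-> R}) n (A : set R) :
  measurable A -> sigma_of_process X (random_sum X (cst n) @^-1` A).
Proof.
move=> mA.
pose G := \bigcup_i g_sigma_algebra_preimage (X i).
suff : measurable_fun [set: g_sigma_algebraType G] (random_sum X (cst n)).
  by move=> /(_ measurableT A mA); rewrite setTI.
rewrite /random_sum/=.
apply: (@measurable_sum _ (g_sigma_algebraType G) R setT _ _
  (fun i : 'I_n => X i : g_sigma_algebraType G -> R)) => i _ B mB.
by apply: sub_sigma_algebra; exists (i : nat) => //; exists B.
Qed.

Lemma nneseries_recl_shift (R : realType) (f : nat -> \bar R) :
  (forall n, 0 <= f n)%E ->
  (\sum_(n <oo) f n = f 0%N + \sum_(n <oo) f n.+1)%E.
Proof.
move=> f0; rewrite nneseries_recl// -(nneseries_addn 1)//.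
by under [in RHS]eq_eseriesr do rewrite -addn1.
Qed.

Section random_index.
Context d (T : measurableType d) (R : realType) (P : probability T R).
Context (theta : R) (N : {RV P >-> nat}).
Hypothesis theta01 : 0 < theta < 1.
Hypothesis N_pmf : forall n : nat, (1 <= n)%N ->
  P (N @^-1` [set n]) = (logarithmic_pmf theta n)%:E.

Lemma probability_series_index (E : set T) : measurable E ->
  (P E = \sum_(n <oo) P (N @^-1` [set n] `&` E))%E.
Proof.
move=> mE; have mN n : measurable (N @^-1` [set n] `&` E).
  apply: measurableI => //; rewrite -[X in measurable X]setTI.
  exact: measurable_funP.
rewrite [in LHS](_ : E = \bigcup_n (N @^-1` [set n] `&` E)); last first.
  by apply/seteqP; split => [w Ew|w [n _ []//]]; exists (N w).
rewrite measure_bigcup//.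
  by apply: eq_eseriesl => n; rewrite in_setT.
apply/trivIsetP => i j _ _ /eqP ij; apply/seteqP; split => // w [[/= iE _] [/= jE _]].
by apply: ij; rewrite -iE -jE.
Qed.

(** [N_pmf] prescribes masses from 1 on only; they already add up to 1, which leaves nothing for
    0. *)
Lemma logarithmic_index_neq0 : P (N @^-1` [set 0%N]) = 0%E.
Proof.
have := probability_series_index measurableT.
rewrite probability_setT nneseries_recl_shift// setIT.
under eq_eseriesr do rewrite setIT N_pmf//.
by rewrite sum_logarithmic_pmf// => e1; rewrite -[LHS](@addeK _ 1%E)// -e1 subee.
Qed.

Lemma probability_logarithmic_index (E : set T) : measurable E ->
  (P E = \sum_(n <oo) P (N @^-1` [set n.+1] `&` E))%E.
Proof.
move=> mE; rewrite [LHS]probability_series_index// nneseries_recl_shift//.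
rewrite (_ : P _ = 0%E) ?add0e//.
have mN : measurable (N @^-1` [set 0%N]).
  by rewrite -[X in measurable X]setTI; exact: measurable_funP.
apply/eqP; rewrite -measure_le0 -logarithmic_index_neq0.
by apply: le_measure => //; apply/mem_set => //; exact: measurableI.
Qed.

End random_index.

(** * The density of the random sum *)

Unset Implicit Arguments.
Set Strict Implicit.

Theorem theorem5 (d : measure_display) (T : measurableType d) (R : realType)
    (P : probability T R) (alpha beta theta : R)
    (Ya : {RV P >-> R}) (Y : nat -> {RV P >-> R}) (N : {RV P >-> nat}) :
  0 < alpha -> 0 < beta -> 0 < theta < 1 ->
  has_pdf P Ya (gamma_pdf alpha) ->
  (forall i : nat, has_pdf P (Y i) (gamma_pdf 1)) ->
  mutually_independent_RV P (fun o : option nat => oapp Y Ya o) ->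
  let X := fun i : nat => (scaled_ratio beta (Y i) Ya : {RV P >-> R}) in
  (forall n : nat, (1 <= n)%N ->
     P (N @^-1` [set n]) = (logarithmic_pmf theta n)%:E) ->
  independent_of_process P N X ->
  has_pdf P (random_sum X N) (log_sum_pdf alpha beta theta).
Proof.
move=> _ beta0 theta01 Ya_pdf Y_pdf indepY X N_pmf indepN.
have [mg g0 gE] := Ya_pdf.
(* The normalisation is read off from the law of [Ya] being a probability. *)
have g1 : (\int[lebesgue_measure]_y (gamma_pdf alpha y)%:E = 1)%E.
  by rewrite -gE// -(probability_setT P).
split.
- exact: measurable_log_sum_pdf.
- exact: log_sum_pdf_ge0.
move=> A mA.
(* In the independent family, [Some i] indexes the numerators and [None] the common denominator
   [Ya]. *)
have Some_inj : injective (@Some nat) by move=> i j [].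
pose S n : {RV P >-> R} := random_sum Y (cst n).
have S_pdf n : has_pdf P (S n.+1) (erlang_pdf n).
  exact: (erlang_partial_sum Some_inj indepY).
pose D : set (R * R) := [set p | A (beta * p.2 / p.1)].
have mD : measurable D.
  rewrite -[X in measurable X]setTI.
  suff : measurable_fun [set: R * R] (fun p : R * R => beta * p.2 / p.1) by exact.
  apply: measurable_funM; first exact: measurable_funM.
  exact: (measurableT_comp (@measurable_invr R)).
(* The factor [beta / Ya] comes out of the sum, also where [Ya] is 0 since both sides are then 0.
   The event concerns the pair of [Ya] and [S n.+1], and one conditions on [Ya]. *)
have SA n : P (random_sum X (cst n.+1) @^-1` A) =
    (\int[lebesgue_measure]_y
       (P (S n.+1 @^-1` xsection D y) * (gamma_pdf alpha y)%:E))%E.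
  rewrite -(independent_pair_pdf Ya_pdf)//; last first.
    move=> B C mB mC.
    exact: (independent_partial_sum Some_inj indepY (j := None)).
  congr (P _); apply/seteqP; split => w;
    by rewrite /D/= /random_sum/= /X/= /scaled_ratio -mulr_suml mulr_sumr.
have mS n : measurable_fun [set: R] (fun y => P (S n.+1 @^-1` xsection D y)).
  exact: (measurable_fun_xsection (distribution P (S n.+1)) mD).
have mSg n : measurable_fun [set: R]
    (fun y => P (S n.+1 @^-1` xsection D y) * (gamma_pdf alpha y)%:E)%E.
  by apply: emeasurable_funM => //; exact/measurable_EFinP.
have Sg0 n y : (0 <= P (S n.+1 @^-1` xsection D y) * (gamma_pdf alpha y)%:E)%E.
  by rewrite mule_ge0// lee_fin.
have pmf0 n : (0 <= (logarithmic_pmf theta n)%:E)%E.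
  by rewrite lee_fin logarithmic_pmf_ge0.
rewrite /distribution /pushforward (probability_logarithmic_index theta01 N_pmf); last first.
  by rewrite -[X in measurable X]setTI; exact: measurable_funP.
transitivity (\sum_(n <oo) \int[lebesgue_measure]_y
    ((logarithmic_pmf theta n.+1)%:E *
     (P (S n.+1 @^-1` xsection D y) * (gamma_pdf alpha y)%:E)))%E.
  apply: eq_eseriesr => n _.
  (* On [N = n.+1] the sum has fixed length, so independence of [N] from the process applies. *)
  have -> : N @^-1` [set n.+1] `&` random_sum X N @^-1` A =
      N @^-1` [set n.+1] `&` random_sum X (cst n.+1) @^-1` A.
    by apply/seteqP; split => w [/= e]; rewrite /random_sum/= e.
  rewrite indepN; last 2 first.
  - by exists [set n.+1] => //; rewrite setTI.
  - exact: sigma_of_process_partial_sum.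
  by rewrite N_pmf// SA -ge0_integralZl//; exact: mSg.
rewrite -integral_nneseries//; last 2 first.
- by move=> n; apply: emeasurable_funM => //; exact: mSg.
- by move=> n y _; rewrite mule_ge0.
(* Both sides are now integrals over the value [y] of [Ya] and are compared pointwise in [y]. *)
rewrite -(integral_log_sum_pdf beta0 theta01 mg g0 g1)//.
apply: eq_integral => y _.
have mDy : measurable (xsection D y) by exact: measurable_xsection.
have -> : [set x | A (beta * x / y)] = xsection D y.
  by apply/seteqP; split => x; rewrite xsectionP.
have merl n : measurable_fun (xsection D y)
    (fun x => (logarithmic_pmf theta n.+1 * erlang_pdf n x)%:E).
  apply/measurable_EFinP; apply: measurable_funTS; apply: measurable_funM => //.
  exact: measurable_erlang_pdf.
(* The closed form is expanded back into its Erlang series, to be matched term by term with the laws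
   of the [S n.+1]. *)
under eq_integral do rewrite -sum_erlang_pdf//.
rewrite integral_nneseries//; last first.
  by move=> n x _; rewrite lee_fin mulr_ge0 ?erlang_pdf_ge0 ?logarithmic_pmf_ge0.
rewrite muleC -nneseriesZl; last first.
  move=> n _; apply: integral_ge0 => x _.
  by rewrite lee_fin mulr_ge0 ?erlang_pdf_ge0 ?logarithmic_pmf_ge0.
apply: eq_eseriesr => n _; have [_ _ SE] := S_pdf n.
rewrite -[P _]/(distribution P (S n.+1) (xsection D y)) SE// muleA muleC.
under [in RHS]eq_integral do rewrite EFinM.
rewrite ge0_integralZl//.
- by apply/measurable_EFinP; apply: measurable_funTS; exact: measurable_erlang_pdf.
- by move=> x _; rewrite lee_fin erlang_pdf_ge0.
Qed.
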